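(* Let $G_I$ be the connected and simply connected Lie group whose Lie algebra $\mathfrak{g}_I$ has a basis $\{x,y,z\}$ with $[x,y]=0$, $[z,x]=x$, $[z,y]=y$. Let $h$ be a left invariant Lorentzian metric on $G_I$ with matrix $[h]$ with respect to $\{x,y,z\}$. In each case below $\{y_1,y_2,y_3\}$ is an $h$-orthonormal basis of $\mathfrak{g}_I$, and the Ricci operator $\mathrm{Ric}$ of $h$ has the stated matrix with respect to it and the stated O'Neill type. (1) If $[h]=\begin{bmatrix} 1&0&0\\0&-1&0\\0&0&\mu\end{bmatrix}$ with $\mu>0$, and $y_1=x$, $y_2=\frac{1}{\sqrt{\mu}}z$, $y_3=y$, then $[\mathrm{Ric}]_{\{y_i\}}=\mathrm{diag}\{-\frac{2}{\mu},-\frac{2}{\mu},-\frac{2}{\mu}\}$ (O'Neill type $\{11,1\}$). (2) If $[h]=\begin{bmatrix} 1&0&0\\0&1&0\\0&0&-\mu\end{bmatrix}$ with $\mu>0$, and $y_1=x$, $y_2=y$, $y_3=\frac{1}{\sqrt{\mu}}z$, then $[\mathrm{Ric}]_{\{y_i\}}=\mathrm{diag}\{\frac{2}{\mu},\frac{2}{\mu},\frac{2}{\mu}\}$ (O'Neill type $\{11,1\}$). (3) If $[h]=\begin{bmatrix} 1&0&0\\0&0&1\\0&1&0\end{bmatrix}$, and $y_1=x$, $y_2=\frac{1}{\sqrt2}(y+z)$, $y_3=\frac{1}{\sqrt2}(y-z)$, then $[\mathrm{Ric}]_{\{y_i\}}=\mathrm{diag}\{0,0,0\}$, i.e. $h$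 is flat (O'Neill type $\{11,1\}$).
   Context: A left invariant Lorentzian metric $h$ on a connected three-dimensional Lie group $G$ is identified with a nondegenerate symmetric bilinear form of signature $(+,+,-)$ on its Lie algebra $\mathfrak{g}$; its matrix $[h]$ in a basis of $\mathfrak{g}$ satisfies $h(u,v)=[u]^t[h][v]$. A basis $\{y_1,y_2,y_3\}$ is $h$-orthonormal if $h(y_1,y_1)=h(y_2,y_2)=1$, $h(y_3,y_3)=-1$ and $h(y_i,y_j)=0$ for $i\ne j$. The Levi-Civita connection $\nabla:\mathfrak{g}\times\mathfrak{g}\to\mathfrak{g}$ is given by $2h(\nabla_uv,w)=h([u,v],w)+h([w,u],v)+h([w,v],u)$. The curvature is $R_{uv}=\nabla_{[u,v]}-(\nabla_u\nabla_v-\nabla_v\nabla_u)$, the Ricci curvature $\mathrm{ric}(u,v)$ is the trace of $w\mapsto R_{uw}v$, and the Ricci operator $\mathrm{Ric}:\mathfrak{g}\to\mathfrak{g}$ is defined by $h(\mathrm{Ric}(u),v)=\mathrm{ric}(u,v)$. The $j$-th column of $[\mathrm{Ric}]_{\{y_i\}}$ is the coordinate vector of $\mathrm{Ric}(y_j)$. O'Neill type $\{11,1\}$ of an $h$-self-adjoint operator: it has a diagonal matrix in some $h$-orthonormal basis. *)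

(* Defs.v *)
From HB Require Import structures.
From mathcomp Require Import all_boot all_order all_algebra.
From mathcomp Require Import classical_sets reals.
From mathcomp Require Import ring.

Set Implicit Arguments.
Unset Strict Implicit.
Unset Printing Implicit Defensive.

Import Order.TTheory GRing.Theory Num.Theory.
Local Open Scope ring_scope.

Definition diag3 (R : realType) (a b c : R) : 'M[R]_3 :=
  diag_mx (\row_j [:: a; b; c]`_j).

Definition mx3 (R : realType) (rows : seq (seq R)) : 'M[R]_3 :=
  \matrix_(i, j) (nth [::] rows i)`_j.

Section Vector.
Variables (R : realType) (g : vectType R).
Implicit Types (h : {symmetric g}) (T : g -> g).

(* Column convention: column j holds the coordinates of T (Y_j), whereas
   mxof of the vector library uses the transposed, row convention. *)
Definition opmx n (Y : n.-tuple g) T : 'M[R]_n :=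
  \matrix_(i, j) coord Y i (T (tnth Y j)).

Definition optrace T : R := \tr (opmx (vbasis {:g}) T).

Definition gram n h (Y : n.-tuple g) : 'M[R]_n :=
  \matrix_(i, j) h (tnth Y i) (tnth Y j).

Definition orthonormal_basis h (Y : 3.-tuple g) : Prop :=
  basis_of {:g} Y /\ gram h Y = diag3 1 1 (-1).

Definition lorentzian h : Prop :=
  nondegenerate h /\ exists Y : 3.-tuple g, orthonormal_basis h Y.

Definition self_adjoint h T : Prop := forall u v, h (T u) v = h u (T v).

Definition oneill_type_11_1 h T : Prop :=
  self_adjoint h T /\
  exists Y : 3.-tuple g, orthonormal_basis h Y /\ is_diag_mx (opmx Y T).

(* The vector representing the linear form phi with respect to h; it exists and
   is unique when h is nondegenerate (see sharpE and sharp_unique). *)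
Definition sharp h (phi : g -> R) : g :=
  xget 0 [set v : g | forall w, h v w = phi w]%classic.

End Vector.

Section LeviCivita.
Variables (R : realType) (g : vectType R).
Variables (br : {bilinear g -> g -> g}) (h : {symmetric g}).

Definition lie_bracket : Prop :=
  (forall u, br u u = 0) /\
  (forall u v w, br u (br v w) + br v (br w u) + br w (br u v) = 0).

Definition levi_civita (u v : g) : g :=
  sharp h (fun w => 2^-1 * (h (br u v) w + h (br w u) v + h (br w v) u)).

(* The sign is opposite to the more common convention; it is compensated by the
   order of the arguments in ricci. *)
Definition curvature (u v w : g) : g :=
  levi_civita (br u v) w
  - (levi_civita u (levi_civita v w) - levi_civita v (levi_civita u w)).

Definition ricci (u v : g) : R := optrace (fun w => curvature u w v).

Definition ricci_op (u : g) : g := sharp h (ricci u).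

Definition flat : Prop := forall u v w, curvature u v w = 0.

End LeviCivita.

Lemma sharp_unique (R : realType) (g : vectType R) (h : {symmetric g}) (u v : g) :
  nondegenerate h -> (forall w, h u w = h v w) -> u = v.
Proof.
move=> /eqP h0 huv; apply/eqP; rewrite -subr_eq0 -memv0 -h0.
by apply/mem_orthovP => w _; rewrite linearBl /= huv subrr.
Qed.

Lemma sharpE (R : realType) (g : vectType R) (h : {symmetric g})
    (phi : {scalar g}) (w : g) :
  nondegenerate h -> h (sharp h phi) w = phi w.
Proof.
move=> hn; set n := \dim {:g}; pose e := vbasis {:g}.
pose f (v : g) : 'rV[R]_n := \row_j h v (tnth e j).
have f_lin : linear f.
  by move=> a u v; apply/rowP => j; rewrite !mxE linearPl.
pose fM := GRing.isLinear.Build _ _ _ _ f f_lin.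
pose fL : {linear g -> 'rV[R]_n} := HB.pack f fM.
have ext (psi1 psi2 : {scalar g}) :
    (forall j, psi1 (tnth e j) = psi2 (tnth e j)) -> psi1 =1 psi2.
  move=> eq12 v; rewrite (coord_vbasis (memvf v)) !linear_sum /=.
  by apply: eq_bigr => i _; rewrite !linearZ /= -!tnth_nth eq12.
have f_inj : lker (linfun fL) == 0%VS.
  apply/lker0P => u v; rewrite !lfunE /= => /rowP fuv.
  apply: (sharp_unique hn); apply: (ext (h u) (h v)) => j.
  by have := fuv j; rewrite !mxE.
have f_surj : limg (linfun fL) = fullv.
  apply/eqP; rewrite eqEdim subvf /= limg_dim_eq ?(eqP f_inj) ?capv0 //.
  by rewrite dimvf /dim /= mul1n.
have /memv_imgP[v _ fv] : \row_j phi (tnth e j) \in limg (linfun fL).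
  by rewrite f_surj memvf.
have : [set v : g | forall w, h v w = phi w]%classic v.
  apply: (ext (h v) phi) => j.
  by move: fv; rewrite lfunE /= => /rowP/(_ j); rewrite !mxE.
by move=> vphi; apply: (@xgetPex _ 0 _ (ex_intro _ v vphi)).
Qed.

Lemma koszul (R : realType) (g : vectType R) (br : {bilinear g -> g -> g})
    (h : {symmetric g}) (u v w : g) : nondegenerate h ->
  2 * h (levi_civita br h u v) w =
  h (br u v) w + h (br w u) v + h (br w v) u.
Proof.
move=> hn; pose phi w := 2^-1 * (h (br u v) w + h (br w u) v + h (br w v) u).
have phi_lin : scalar phi.
  move=> a w1 w2; rewrite /phi (linearPr h) !(linearPl br) !(linearPl h) /=.
  by ring.
pose phiM := GRing.isLinear.Build _ _ _ _ phi phi_lin.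
pose phiL : {scalar g} := HB.pack phi phiM.
by rewrite (sharpE phiL w hn) /= /phi mulrA divff ?mul1r ?pnatr_eq0.
Qed.

Lemma levi_civita_linear (R : realType) (g : vectType R)
    (br : {bilinear g -> g -> g}) (h : {symmetric g}) (u : g) :
  nondegenerate h -> linear (levi_civita br h u).
Proof.
move=> hn a v1 v2; apply: (sharp_unique hn) => w.
have n2 : (2 : R) != 0 by rewrite pnatr_eq0.
apply: (mulfI n2); rewrite (linearPl h) /= mulrDr mulrCA !koszul //.
rewrite !(linearPr br) !(linearPl h) !(linearPr h) /=; ring.
Qed.

Lemma ricci_opE (R : realType) (g : vectType R) (br : {bilinear g -> g -> g})
    (h : {symmetric g}) (u v : g) :
  nondegenerate h -> h (ricci_op br h u) v = ricci br h u v.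
Proof.
move=> hn; have ric_lin : scalar (ricci br h u).
  move=> a v1 v2; rewrite /ricci /optrace /mxtrace mulr_sumr -big_split /=.
  apply: eq_bigr => i _; rewrite !mxE -linearP; congr (coord _ _ _).
  have subP (b : R) (p q r s : g) :
      b *: p + q - (b *: r + s) = b *: (p - r) + (q - s).
    by rewrite scalerBr opprD addrACA.
  by rewrite /curvature !(levi_civita_linear br _ hn) !subP.
pose ricM := GRing.isLinear.Build _ _ _ _ (ricci br h u) ric_lin.
pose ricL : {scalar g} := HB.pack (ricci br h u) ricM.
exact: (sharpE ricL v hn).
Qed.

(* Main.v *)
(* Writing l for the linear form with l x = l y = 0 and l z = 1, the bracket of
   g_I is [u, v] = l(u) v - l(v) u.  If n is the vector representing l with
   respect to h, the Koszul formula gives nabla_u v = h(u, v) n - l(v) u, hence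
   R_uv w = h(n, n) (h(v, w) u - h(u, w) v): every metric on g_I has constant
   curvature and Ric = - 2 h(n, n) id.  In the three cases n is z / mu,
   - z / mu and y, so that h(n, n) is 1 / mu, - 1 / mu and 0. *)
Require Import Defs.
From HB Require Import structures.
From mathcomp Require Import all_boot all_order all_algebra.
From mathcomp Require Import classical_sets reals.
From mathcomp Require Import ring.

Set Implicit Arguments.
Unset Strict Implicit.
Unset Printing Implicit Defensive.

Import Order.TTheory GRing.Theory Num.Theory.
Local Open Scope ring_scope.

Section Bases.
Variables (R : realType) (g : vectType R).
Implicit Types (h : {symmetric g}).

Lemma symmetric_formC h u v : h u v = h v u.
Proof. by rewrite hermC expr0 mul1r. Qed.

(** Reduces a Gram matrix to its six independent entries. It serves both to read the given matrix of
    [h] and, through [diag3E], to check that the new bases are orthonormal. *)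
Lemma gram3P h u v w a b c d e f :
  gram h [tuple u; v; w] = mx3 [:: [:: a; b; c]; [:: b; d; e]; [:: c; e; f]] <->
  [/\ h u u = a, h v v = d & h w w = f] /\ [/\ h u v = b, h u w = c & h v w = e].
Proof.
split=> [/matrixP G|[[uu vv ww] [uv uw vw]]].
  have G3 (i j : 'I_3) := G i j.
  split; split; [move: (G3 0 0) | move: (G3 1 1) | move: (G3 2 2)
    | move: (G3 0 1) | move: (G3 0 2) | move: (G3 1 2)]; by rewrite !mxE.
have vu := symmetric_formC h v u; have wu := symmetric_formC h w u.
have wv := symmetric_formC h w v.
apply/matrixP => -[[|[|[|i]]] // ?] -[[|[|[|j]]] // ?];
  by rewrite !mxE !(tnth_nth 0) /= ?vu ?wu ?wv.
Qed.

Lemma diag3E (a b c : R) :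
  diag3 a b c = mx3 [:: [:: a; 0; 0]; [:: 0; b; 0]; [:: 0; 0; c]].
Proof.
by apply/matrixP => -[[|[|[|i]]] // ?] -[[|[|[|j]]] // ?]; rewrite !mxE.
Qed.

(** Pairing a vanishing combination of [Y] with each vector of [Y] shows that its row of
    coefficients is killed by the Gram matrix, hence zero; as many free vectors as the dimension
    form a basis. *)
Lemma gram_unit_basis n h (Y : n.-tuple g) :
  \dim {:g} = n -> gram h Y \in unitmx -> basis_of {:g} Y.
Proof.
move=> dimg unitG; rewrite basisEfree subvf size_tuple dimg leqnn !andbT.
apply/freeP => k Yk0 i.
suff /rowP/(_ i) : \row_j k j = 0 :> 'rV[R]_n by rewrite !mxE.
apply: (can_inj (mulmxK unitG)); rewrite mul0mx; apply/rowP => j.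
rewrite !mxE -[RHS](linear0l h (tnth Y j)) -Yk0 linear_sumlz.
by apply: eq_bigr => l _; rewrite !mxE linearZl_LR /= -tnth_nth.
Qed.

Lemma orthonormal_basis_gram h (Y : 3.-tuple g) :
  \dim {:g} = 3 -> gram h Y = diag3 1 1 (-1) -> orthonormal_basis h Y.
Proof.
move=> dimg GY; split=> //; apply: (@gram_unit_basis _ h) => //.
by rewrite GY unitmxE det_diag !big_ord_recl big_ord0 !mxE /= !mul1r mulr1 unitrN1.
Qed.

Lemma opmx_scale (Y : 3.-tuple g) (T : g -> g) (c : R) :
  basis_of {:g} Y -> (forall u, T u = c *: u) -> opmx Y T = diag3 c c c.
Proof.
move=> /basis_free freeY TE; apply/matrixP => i j.
rewrite !mxE TE linearZ /= (tnth_nth 0) coord_free // mulr_natr eq_sym.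
by congr (_ *+ _); case: i => [[|[|[|i]]] ?].
Qed.

(** Expanding [u] in the basis shows that the rank-one map [w |-> phi w *: u] has trace [phi u]; the
    identity has trace the dimension. *)
Lemma optrace_scaleB (T : g -> g) (phi : {scalar g}) (u : g) (c : R) :
  (forall w, T w = phi w *: u - c *: w) ->
  optrace T = phi u - c * (\dim {:g})%:R.
Proof.
move=> TE; pose e := vbasis {:g}.
have free_e : free e := basis_free (vbasisP _).
rewrite /optrace /mxtrace.
rewrite (eq_bigr (fun i => coord e i u * phi e`_i - c)) => [|i _].
  rewrite sumrB sumr_const card_ord mulr_natr; congr (_ - _).
  rewrite [in RHS](coord_vbasis (memvf u)) linear_sum /=.
  by apply: eq_bigr => i _; rewrite linearZ.
by rewrite mxE TE linearB !linearZ /= (tnth_nth 0) coord_free // eqxx mulr1 mulrC.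
Qed.

End Bases.

Section ConstantCurvature.
Variables (R : realType) (g : vectType R).
Variables (br : {bilinear g -> g -> g}) (h : {symmetric g}) (n : g).
Hypothesis (h_nondeg : nondegenerate h).
Hypothesis (brE : forall u v, br u v = h n u *: v - h n v *: u).

Let linE := (linearBl, linearBr, linearDl, linearDr, linearZl_LR, linearZr_LR).

Lemma levi_civitaE u v : levi_civita br h u v = h u v *: n - h n v *: u.
Proof.
(* By nondegeneracy it suffices to pair with an arbitrary [w], which leaves a polynomial identity in
   values of [h]. The same device recurs below. *)
apply: (sharp_unique h_nondeg) => w.
have n2 : (2 : R) != 0 by rewrite pnatr_eq0.
apply: (mulfI n2); rewrite koszul // !brE !linE /=.
rewrite (symmetric_formC h v u) (symmetric_formC h w u) (symmetric_formC h w v).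
by ring.
Qed.

(** The factor [h n n] comes from differentiating [n] itself: its derivative along [u] is
    [h u n *: n - h n n *: u]. All terms without this factor cancel. *)
Lemma curvatureE u v w :
  curvature br h u v w = h n n *: (h v w *: u - h u w *: v).
Proof.
apply: (sharp_unique h_nondeg) => t.
rewrite /curvature brE !levi_civitaE !linE /=.
rewrite (symmetric_formC h v u) (symmetric_formC h u n) (symmetric_formC h v n).
by ring.
Qed.

Lemma ricci_op_scale u :
  ricci_op br h u = (h n n * (1 - (\dim {:g})%:R)) *: u.
Proof.
apply: (sharp_unique h_nondeg) => v.
(* For fixed [u] and [v], the map [w |-> R_uw v] is a rank-one map minus a multiple of the
   identity. *)
have tr : ricci br h u v = h v (h n n *: u) - h n n * h u v * (\dim {:g})%:R.
  apply: (optrace_scaleB (phi := h v)) => w.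
  by rewrite curvatureE scalerBr !scalerA mulrC (symmetric_formC h w v).
by rewrite ricci_opE // tr !linE /= (symmetric_formC h v u); ring.
Qed.

Lemma flat_of_null : h n n = 0 -> flat br h.
Proof. by move=> n0 u v w; rewrite curvatureE n0 scale0r. Qed.

(** A scalar operator is self-adjoint and has the same diagonal matrix in every basis, so [Y] itself
    witnesses the O'Neill type. *)
Lemma ricci_op_orthonormal (Y : 3.-tuple g) (c : R) :
  \dim {:g} = 3 -> gram h Y = diag3 1 1 (-1) -> c = - (2 * h n n) ->
  [/\ orthonormal_basis h Y, opmx Y (ricci_op br h) = diag3 c c c
    & oneill_type_11_1 h (ricci_op br h)].
Proof.
move=> dimg GY cE; have onY := orthonormal_basis_gram dimg GY.
have ricE u : ricci_op br h u = c *: u.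
  by rewrite ricci_op_scale dimg cE; congr (_ *: _); ring.
have ricY := opmx_scale onY.1 ricE.
split=> //; split=> [u v|]; first by rewrite !ricE linearZl_LR linearZr_LR.
by exists Y; split=> //; rewrite ricY diag_mx_is_diag.
Qed.

End ConstantCurvature.

Section Bracket.
Variables (R : realType) (g : vectType R).
Variables (br : {bilinear g -> g -> g}) (h : {symmetric g}) (x y z : g).
Hypothesis (br_lie : lie_bracket br).
Hypothesis (basis_xyz : basis_of {:g} [tuple x; y; z]).
Hypotheses (brxy : br x y = 0) (brzx : br z x = x) (brzy : br z y = y).

Let linE := (linearBl, linearBr, linearDl, linearDr, linearZl_LR, linearZr_LR).

Lemma lie_bracketC u v : br u v = - br v u.
Proof.
apply/eqP; rewrite -addr_eq0; apply/eqP.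
by have := br_lie.1 (u + v); rewrite !linE !br_lie.1 add0r addr0 addrC.
Qed.

(** The conditions on [n] say that [h n] is the coordinate form of [z] in the basis [x, y, z]. Both
    sides are bilinear, so the given brackets decide. *)
Lemma bracketE (n : g) : nondegenerate h ->
  h n x = 0 -> h n y = 0 -> h n z = 1 ->
  forall u v, br u v = h n u *: v - h n v *: u.
Proof.
move=> h_nondeg nx ny nz u v.
have decomp w : exists a b c, w = a *: x + b *: y + c *: z.
  have := coord_basis basis_xyz (memvf w).
  rewrite !big_ord_recl big_ord0 /= addr0 addrA => ->.
  by do 3 eexists.
have [a [b [c ->]]] := decomp u; have [a' [b' [c' ->]]] := decomp v.
have bryx : br y x = 0 by rewrite lie_bracketC brxy oppr0.
have brxz : br x z = - x by rewrite lie_bracketC brzx.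
have bryz : br y z = - y by rewrite lie_bracketC brzy.
apply: (sharp_unique h_nondeg) => t.
rewrite !linE /= !br_lie.1 brxy bryx brzx brxz brzy bryz nx ny nz.
rewrite !linearNl !linear0l.
ring.
Qed.

End Bracket.

Theorem theorem3p9 (R : realType) (g : vectType R) (br : {bilinear g -> g -> g})
    (x y z : g) (h : {symmetric g}) :
  lie_bracket br ->
  basis_of {:g} [tuple x; y; z] ->
  br x y = 0 -> br z x = x -> br z y = y ->
  lorentzian h ->
  [/\ forall mu : R, 0 < mu ->
        gram h [tuple x; y; z] = mx3 [:: [:: 1;  0;  0];
                                         [:: 0; -1;  0];
                                         [:: 0;  0; mu]] ->
        let Y := [tuple x; (Num.sqrt mu)^-1 *: z; y] in
        [/\ orthonormal_basis h Y,
            opmx Y (ricci_op br h) = diag3 (- (2 / mu)) (- (2 / mu)) (- (2 / mu))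
          & oneill_type_11_1 h (ricci_op br h)],
      forall mu : R, 0 < mu ->
        gram h [tuple x; y; z] = mx3 [:: [:: 1; 0;    0];
                                         [:: 0; 1;    0];
                                         [:: 0; 0; - mu]] ->
        let Y := [tuple x; y; (Num.sqrt mu)^-1 *: z] in
        [/\ orthonormal_basis h Y,
            opmx Y (ricci_op br h) = diag3 (2 / mu) (2 / mu) (2 / mu)
          & oneill_type_11_1 h (ricci_op br h)]
    & gram h [tuple x; y; z] = mx3 [:: [:: 1; 0; 0];
                                       [:: 0; 0; 1];
                                       [:: 0; 1; 0]] ->
      let Y := [tuple x; (Num.sqrt 2)^-1 *: (y + z); (Num.sqrt 2)^-1 *: (y - z)] in
      [/\ orthonormal_basis h Y,
          opmx Y (ricci_op br h) = diag3 0 0 0,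
          flat br h
        & oneill_type_11_1 h (ricci_op br h)]].
Proof.
move=> br_lie basis_xyz brxy brzx brzy [h_nondeg _].
have dimg : \dim {:g} = 3 := size_basis basis_xyz.
have brE n := bracketE br_lie basis_xyz brxy brzx brzy (n := n) h_nondeg.
pose linE := (linearBl h, linearBr h, linearDl h, linearDr h,
              linearZl_LR h, linearZr_LR h).
have zx := symmetric_formC h z x; have zy := symmetric_formC h z y.
have inv_sqrt_sqr (a : R) : 0 < a -> (Num.sqrt a)^-1 * (Num.sqrt a)^-1 = a^-1.
  by move=> a_gt0; rewrite -invfM -expr2 sqr_sqrtr // ltW.
split=> [mu mu_gt0 | mu mu_gt0 |] /gram3P[[xx yy zz] [xy xz yz]] Y.
- have mu_neq0 : mu != 0 by rewrite gt_eqF.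
  (* [z] is orthogonal to [x] and [y] with [h z z = mu], so dividing by [mu] makes [h n z = 1]. *)
  apply: (ricci_op_orthonormal (n := mu^-1 *: z)) => //.
  + by apply: brE; rewrite linE /= ?zx ?zy ?xz ?yz ?zz ?mulr0 // mulVf.
  + rewrite diag3E; apply/gram3P; rewrite !linE /= xx yy zz xy xz zy yz.
    by rewrite mulrA inv_sqrt_sqr // mulVf // mulr0.
  + by rewrite !linE /= zz; field.
- have mu_neq0 : mu != 0 by rewrite gt_eqF.
  (* Now [h z z = - mu], hence the sign of [n]. *)
  apply: (ricci_op_orthonormal (n := - mu^-1 *: z)) => //.
  + by apply: brE; rewrite linE /= ?zx ?zy ?xz ?yz ?zz ?mulr0 // mulrNN mulVf.
  + rewrite diag3E; apply/gram3P; rewrite !linE /= xx yy zz xy xz yz.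
    by rewrite mulrA inv_sqrt_sqr // mulrN mulVf // mulr0.
  + by rewrite !linE /= zz; field.
- have yx := symmetric_formC h y x.
  (* The null vector [y] is orthogonal to [x] and pairs to 1 with [z]; [h y y = 0] gives both the
     zero Ricci operator and flatness. *)
  have bry : forall u v, br u v = h y u *: v - h y v *: u.
    by apply: brE; rewrite ?yx ?xy.
  have [|||onY ricY oneill] := ricci_op_orthonormal h_nondeg bry (Y := Y) (c := 0).
  + by [].
  (* [y + z] and [y - z] are orthogonal, with squares [2] and [- 2]. *)
  + rewrite diag3E; apply/gram3P; rewrite !linE /= xx yy zz xy xz zy yz.
    rewrite !(mulrDr, mulrN, add0r, sub0r, oppr0, addr0, mulr0, mulr1).
    rewrite !inv_sqrt_sqr ?ltr0n //.
    by split; split; field.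
  + by rewrite yy mulr0 oppr0.
  by split=> //; apply: (flat_of_null h_nondeg bry).
Qed.
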